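(* Let $k\geq 3$ be an odd integer. For any coloring $\Delta\colon\mathbb{N}\to\mathbb{N}$ there is an infinite set $X=\{x_1<x_2<\cdots\}\subseteq\mathbb{N}$ such that, writing $X^{**}_{alt}=X^{**}_{alt}(k)=\{\sum^{**}_{j\in J}x_j : J\in\binom{\mathbb{N}}{k}\}$, the sets $X$ and $X^{**}_{alt}$ are colored according to one of the following patterns: (i) $X\cup X^{**}_{alt}$ is monochromatic; or (ii) $X\cup X^{**}_{alt}$ is rainbow; or (iii) $X$ is rainbow and $\Delta(\sum^{**}_{j\in J}x_j)=\Delta(x_{\max J})$ for all $J\in\binom{\mathbb{N}}{k}$. None of these three patterns may be omitted without violating the theorem, i.e., for each pattern there is a coloring $\Delta\colon\mathbb{N}\to\mathbb{N}$ such that no infinite $X\subseteq\mathbb{N}$ satisfies either of the other two patterns.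
   Context: $\mathbb{N}$ denotes the set of positive integers; $\binom{\mathbb{N}}{k}$ is the set of $k$-element subsets of $\mathbb{N}$. The elements of $X$ are indexed increasingly $x_1<x_2<\cdots$, and for odd $k$ and $J=\{j_1<j_2<\cdots<j_k\}$, $\sum^{**}_{j\in J}x_j=x_{j_k}-x_{j_{k-1}}+x_{j_{k-2}}-x_{j_{k-3}}+\cdots+x_{j_3}-x_{j_2}+x_{j_1}$. Monochromatic: all elements receive the same color; rainbow: all elements receive pairwise distinct colors. *)

(* Defs.v *)
From mathcomp Require Import all_boot all_order all_algebra finmap.
From mathcomp Require Import boolp classical_sets functions cardinality.

Set Implicit Arguments.
Unset Strict Implicit.
Unset Printing Implicit Defensive.

Local Open Scope classical_set_scope.
Local Open Scope nat_scope.

Definition posint : set nat := [set n | 0 < n].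

(* Maps N -> N with N the positive integers are represented by maps nat -> nat
   whose value at 0 is irrelevant. *)
Definition coloring (D : nat -> nat) : Prop := forall n, posint n -> posint (D n).

(* X = {x 1 < x 2 < ...}; the value x 0 is irrelevant. *)
Definition increasing_enum (x : nat -> nat) (X : set nat) : Prop :=
  (forall i j, 0 < i -> i < j -> x i < x j) /\ X = x @` posint.

Definition infinite_set_of_posint (X : set nat) : Prop :=
  X `<=` posint /\ infinite_set X.

Definition ksubsets (k : nat) : set {fset nat} :=
  [set J | [set` J] `<=` posint /\ #|` J| = k].

(* The subtractions are never truncated when s is decreasing; see altsumE. *)
Fixpoint altsum (s : seq nat) : nat :=
  match s with
  | [::] => 0
  | [:: a] => a
  | [:: a, b & s'] => (a - b) + altsum s'
  end.

Lemma altsumE (s : seq nat) : sorted gtn s ->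
  ((altsum s)%:Z = \sum_(i < size s) (-1) ^+ i * (nth 0%N s i)%:Z)%R.
Proof.
move: {2}(size s) (leqnn (size s)) => n; elim/ltn_ind: n s => n IHn.
case=> [|a [|b s]] /= sz_s.
- by rewrite big_ord0.
- by rewrite big_ord_recl big_ord0 /= GRing.expr0 GRing.mul1r GRing.addr0.
case/andP=> ltba sorted_s.
rewrite !big_ord_recl /= GRing.expr0 GRing.expr1 GRing.mul1r GRing.mulN1r.
rewrite GRing.addrA PoszD -subzn ?(ltnW ltba)//; congr (_ + _)%R.
rewrite (IHn (size s)) ?(path_sorted sorted_s) ?(ltnW sz_s) //.
by apply: eq_bigr => i _; rewrite !GRing.exprS !GRing.mulrA GRing.mulrNN !GRing.mul1r.
Qed.

(* x_{j_k} - x_{j_{k-1}} + ... - x_{j_2} + x_{j_1} for J = {j_1 < ... < j_k} *)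
Definition sumalt (x : nat -> nat) (J : {fset nat}) : nat :=
  altsum [seq x j | j <- sort geq J].

Definition Xalt (k : nat) (x : nat -> nat) : set nat :=
  sumalt x @` ksubsets k.

Definition monochromatic (D : nat -> nat) (A : set nat) : Prop :=
  exists c, forall a, A a -> D a = c.

Definition rainbow (D : nat -> nat) (A : set nat) : Prop :=
  forall a b, A a -> A b -> a <> b -> D a <> D b.

Definition pattern_mono (k : nat) (D : nat -> nat) (X : set nat)
    (x : nat -> nat) : Prop :=
  monochromatic D (X `|` Xalt k x).

Definition pattern_rainbow (k : nat) (D : nat -> nat) (X : set nat)
    (x : nat -> nat) : Prop :=
  rainbow D (X `|` Xalt k x).

Definition pattern_max (k : nat) (D : nat -> nat) (X : set nat)
    (x : nat -> nat) : Prop :=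
  rainbow D X /\
  forall J, ksubsets k J -> D (sumalt x J) = D (x (\max_(j <- J) j)).

(* Main.v *)
(** Let [U] be an idempotent ultrafilter on the natural numbers.  Call [a]
    stable for a coloring [f] if [f (a + b) = f a] for [U]-almost all [b], and
    look for stable points of [D] and of the coloring sending [s] to the germ
    along [U] of [y |-> D (s + y)].  The terms z_1, z_2, ... are picked greedily
    inside sets of [U], and x_j = z_0 + ... + z_j; then the x_j and their
    alternating sums are sums of z over finite sets of indices containing 0.
    If z_0 can be taken stable for [D], all these sums receive the color of z_0.
    Otherwise, if z_0 can be taken stable for the germs, all the sums have the
    same germ, so the color of a sum depends, injectively, on its last term
    only.  If there are no stable points at all, then [D (s + y)] and the germ
    at [s + y] avoid any given value for almost all [y], and both colorings are
    kept injective on the sums.  The patterns are forced, respectively, by a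
    constant coloring, by the identity and by the integer part of log_2. *)

Require Import Defs.
From mathcomp Require Import all_boot all_order all_algebra finmap.
From mathcomp Require Import boolp classical_sets functions cardinality filter.
From mathcomp Require Import zify.

Set Implicit Arguments.
Unset Strict Implicit.
Unset Printing Implicit Defensive.

Local Open Scope classical_set_scope.
Local Open Scope nat_scope.

(** * Idempotent ultrafilters on a semigroup *)

Section FilterMul.
Variables (T : Type) (op : T -> T -> T).
Implicit Types (F G H U : set_system T).

Definition filter_mul F G : set_system T :=
  [set A | \forall x \near F, \forall y \near G, A (op x y)].

Lemma filter_mul_sub F F' G G' : Filter F ->
  F `<=` F' -> G `<=` G' -> filter_mul F G `<=` filter_mul F' G'.
Proof.
move=> FF FF' GG' A FGA; apply: FF'.
by move: FGA; apply: (@filterS _ F) => x; exact: GG'.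
Qed.

Lemma filter_mul_filter F G : Filter F -> Filter G -> Filter (filter_mul F G).
Proof.
move=> FF FG; split.
- by apply: (@nearW _ F) => x; exact: filterT.
- by move=> A B; apply: (@filterS2 _ F) => x; exact: filterI.
- by move=> A B AB; apply: (@filterS _ F) => x; apply: filterS => y; exact: AB.
Qed.

Lemma filter_mul_proper F G :
  ProperFilter F -> ProperFilter G -> ProperFilter (filter_mul F G).
Proof.
move=> FF FG; apply: Build_ProperFilter; last exact: filter_mul_filter.
by move=> /(@filter_ex _ F)[x /filter_ex[]].
Qed.

(* For a maximal filter the inclusion is an equality. *)
Definition idempotent_filter F : Prop :=
  ProperFilter F /\ F `<=` filter_mul F F.

Definition maximal_idempotent_filter F : Prop :=
  idempotent_filter F /\ forall G, idempotent_filter G -> F `<=` G -> G `<=` F.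

Lemma bigcup_chain_idempotent (C : set (set_system T)) :
  C !=set0 -> total_on C subset -> C `<=` idempotent_filter ->
  idempotent_filter (\bigcup_(F in C) F).
Proof.
move=> [F CF] totC idC; split.
- apply: Build_ProperFilter.
    by move=> [G CG]; have [GP _] := idC _ CG; exact: filter_not_empty.
  split.
  + by exists F => //; have [FP _] := idC _ CF; exact: filterT.
  + move=> A B [G CG GA] [H CH HB].
    have [GP _] := idC _ CG; have [HP _] := idC _ CH.
    have [GH|HG] := totC _ _ CG CH.
      by exists H => //; apply: filterI => //; exact: GH.
    by exists G => //; apply: filterI => //; exact: HG.
  + move=> A B AB [G CG GA]; exists G => //.
    by have [GP _] := idC _ CG; exact: filterS GA.
- move=> A [G CG GA]; have [GP idG] := idC _ CG.
  exists G => //.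
  by move: (idG _ GA); apply: (@filterS _ G) => x; exists G.
Qed.

Lemma exists_maximal_idempotent_filter F0 : idempotent_filter F0 ->
  exists2 F, maximal_idempotent_filter F & F0 `<=` F.
Proof.
move=> idF0.
have [C idC totC|F [idF maxF]] :=
    @Zorn_bigcup _ [set F | idempotent_filter (F0 `|` F)].
  have [C0|/set0P[F CF]] := eqVneq C set0.
    by rewrite /mkset C0 bigcup_set0 setU0.
  rewrite /mkset -bigcupUr; last by exists F.
  rewrite -(bigcup_image _ (setU F0) id).
  apply: bigcup_chain_idempotent.
  - by exists (F0 `|` F), F.
  - move=> _ _ [G CG <-] [H CH <-].
    by have [GH|HG] := totC _ _ CG CH; [left|right]; exact: setUS.
  - by move=> _ [G CG <-]; exact: idC.
exists (F0 `|` F); last by left.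
split=> // G idG FG; apply: contrapT => nGF; apply: (maxF G).
  by split=> [A FA|GF]; [apply: FG; right|apply: nGF => A /GF; right].
by rewrite /mkset setUidr // => A F0A; apply: FG; left.
Qed.

Hypothesis opA : associative op.

Lemma filter_mulA F G H :
  filter_mul F (filter_mul G H) = filter_mul (filter_mul F G) H.
Proof.
apply/funext => A; congr F; apply/funext => x; congr G; apply/funext => y.
by congr H; apply/funext => z /=; rewrite opA.
Qed.

Lemma filter_mul_idempotent F G :
  idempotent_filter F -> ProperFilter G -> F `<=` G ->
  idempotent_filter (filter_mul F G).
Proof.
move=> [FP idF] GP FG; split; first exact: filter_mul_proper.
rewrite filter_mulA; apply: filter_mul_sub => //; rewrite -filter_mulA.
apply: (subset_trans idF); apply: filter_mul_sub => //.
by apply: (subset_trans idF); exact: filter_mul_sub.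
Qed.

Lemma filter_mul_maximal F G : maximal_idempotent_filter F ->
  ProperFilter G -> F `<=` G -> filter_mul F G `<=` F.
Proof.
move=> [idF maxF] GP FG; apply: maxF; first exact: filter_mul_idempotent.
by case: idF => FP idF; apply: (subset_trans idF); exact: filter_mul_sub.
Qed.

(* The filter generated by [F] and the sets {x | x^-1 A in U} for A in U. *)
Definition quotient_filter F U : set_system T :=
  [set B | exists2 A, U A &
     \forall x \near F, (\forall y \near U, A (op x y)) -> B x].

Lemma sub_quotient_filter F U : Filter F -> Filter U ->
  F `<=` quotient_filter F U.
Proof.
move=> FF UF A FA; exists setT; first exact: filterT.
by apply: filterS FA => x.
Qed.

Lemma quotient_filter_filter F U : Filter F -> Filter U ->
  Filter (quotient_filter F U).
Proof.
move=> FF UF; split.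
- by apply: (@sub_quotient_filter F U); exact: filterT.
- move=> B B' [A UA FB] [A' UA' FB']; exists (A `&` A'); first exact: filterI.
  apply: filterS2 FB FB' => x Bx B'x UAA'.
  by split; [apply: Bx|apply: B'x]; apply: filterS UAA' => y [].
- move=> B B' BB' [A UA FB]; exists A => //.
  by apply: filterS FB => x Bx /Bx; exact: BB'.
Qed.

Lemma quotient_filter_proper F U : ProperFilter F -> UltraFilter U ->
  filter_mul F U `<=` U -> ProperFilter (quotient_filter F U).
Proof.
move=> FP UU FUU; apply: Build_ProperFilter; last exact: quotient_filter_filter.
move=> [A UA FA]; suff UnA : U (~` A).
  by apply: (@filter_not_empty _ U); rewrite -(setICr A); exact: filterI.
apply: FUU; apply: filterS FA => x nUA.
by have [/nUA|] := in_ultra_setVsetC [set y | A (op x y)] UU.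
Qed.

Lemma quotient_filter_idempotent F U :
  idempotent_filter F -> UltraFilter U -> filter_mul F U `<=` U ->
  idempotent_filter (quotient_filter F U).
Proof.
move=> [FP idF] UU FUU; split; first exact: quotient_filter_proper.
move=> B [A UA FB]; exists A => //.
apply: filterS (idF _ FB : F _) => x FBx UAx.
exists [set y | A (op x y)] => //.
apply: filterS FBx => y Bxy UAxy; apply: Bxy.
by apply: filterS UAxy => z /=; rewrite opA.
Qed.

(* Ellis-Numakura, phrased with filters: by maximality of [F], neither [F * U]
   nor the quotient filter is larger than [F]; the latter says [U <= U * U]. *)
Theorem exists_idempotent_ultrafilter F0 : idempotent_filter F0 ->
  exists U, [/\ UltraFilter U, F0 `<=` U & U `<=` filter_mul U U].
Proof.
move=> /exists_maximal_idempotent_filter[F maxF F0F].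
have [[FP idF] Fmax] := maxF.
have [U [UU FU]] := ultraFilterLemma FP.
have FUF : filter_mul F U `<=` F by exact: filter_mul_maximal.
have quotF : quotient_filter F U `<=` F.
  apply: Fmax; last exact: sub_quotient_filter.
  by apply: quotient_filter_idempotent => //; exact: subset_trans FU.
exists U; split=> // [|A UA]; first exact: subset_trans FU.
by apply/FU/quotF; exists A => //; exact: nearW.
Qed.

End FilterMul.

Lemma eventually_idempotent : idempotent_filter addn \oo.
Proof.
split; first exact: eventually_filter.
move=> A [n _ nA]; apply: (@nearW _ \oo) => x; exists n => // y /= ny.
by apply: nA => /=; lia.
Qed.

Corollary exists_idempotent_ultrafilter_nat :
  exists U, [/\ UltraFilter U, \oo `<=` U & U `<=` filter_mul addn U U].
Proof. exact: exists_idempotent_ultrafilter addnA _ eventually_idempotent. Qed.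

(** * Sums over finite sets of indices containing 0 *)

Definition adjoin (L : {fset nat}) (d : nat) : {fset nat} :=
  (L `|` [fset (s + d)%N | s in L])%fset.

Lemma adjoinP (L : {fset nat}) d s :
  reflect (s \in L \/ exists2 t, t \in L & s = t + d) (s \in adjoin L d).
Proof.
rewrite in_fsetU; apply: (iffP orP) => -[sL|]; try by left.
- by move=> /imfsetP[t /= tL ->]; right; exists t.
- by move=> [t tL ->]; right; apply/imfsetP; exists t.
Qed.

Lemma adjoin_injective (C : Type) (f : nat -> C) (L : {fset nat}) d :
  {in L &, injective f} ->
  {in L &, forall s t, f (s + d) <> f t} ->
  {in L &, forall s t, f (s + d) = f (t + d) -> s = t} ->
  {in adjoin L d &, injective f}.
Proof.
move=> inj_old ne_new inj_new s t.
move=> /adjoinP[sL|[s' sL ->]] /adjoinP[tL|[t' tL ->]] fst.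
- exact: inj_old.
- by case: (ne_new t' s tL sL).
- by case: (ne_new s' t sL tL).
- by rewrite (inj_new s' t').
Qed.

(* The sums of [z] over the subsets of {0, ..., n} that contain 0. *)
Fixpoint rooted_sums (z : nat -> nat) (n : nat) : {fset nat} :=
  if n is m.+1 then adjoin (rooted_sums z m) (z m.+1) else [fset z 0]%fset.

Definition all_rooted_sums (z : nat -> nat) : set nat :=
  [set s | exists n, s \in rooted_sums z n].

Definition partial_sum (z : nat -> nat) (n : nat) : nat := \sum_(i < n.+1) z i.

Section RootedSums.
Variable z : nat -> nat.

Lemma partial_sumS n : partial_sum z n.+1 = partial_sum z n + z n.+1.
Proof. exact: big_ord_recr. Qed.

Lemma leq_partial_sum : {homo partial_sum z : m n / m <= n}.
Proof.
apply: homo_leq => [//|? ? ?|n]; first exact: leq_trans.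
by rewrite partial_sumS leq_addr.
Qed.

Lemma rooted_sums_add n s :
  s \in rooted_sums z n -> s + z n.+1 \in rooted_sums z n.+1.
Proof. by move=> sn; apply/adjoinP; right; exists s. Qed.

Lemma rooted_sums_sub m n :
  m <= n -> {subset rooted_sums z m <= rooted_sums z n}.
Proof.
move: m n; apply: homo_leq => [L s //|L1 L2 L3 L12 L23 s /L12/L23 //|n s sn].
by apply/adjoinP; left.
Qed.

Lemma partial_sum_rooted n : partial_sum z n \in rooted_sums z n.
Proof.
elim: n => [|n IHn]; first by rewrite /partial_sum big_ord1 inE.
by rewrite partial_sumS rooted_sums_add.
Qed.

Lemma rooted_sums_shift m n s : m <= n -> s \in rooted_sums z m ->
  s + (partial_sum z n - partial_sum z m) \in rooted_sums z n.
Proof.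
move=> /subnK<-; elim: (n - m) => [|i IHi] sm; first by rewrite subnn addn0.
have le_psum : partial_sum z m <= partial_sum z (i + m).
  by apply: leq_partial_sum; rewrite leq_addl.
rewrite addSn partial_sumS -addnBAC // addnA.
exact/rooted_sums_add/IHi.
Qed.

Lemma altsum_partial_sum m (s : seq nat) :
  sorted gtn (m.+1 :: s) -> ~~ odd (size s) -> all (leq 1) s ->
  exists2 t, t \in rooted_sums z m &
             altsum [seq partial_sum z j | j <- m.+1 :: s] = t + z m.+1.
Proof.
have [n] := ubnP (size s); elim: n s m => // n IHn [|b [|[|c] s]] m //=.
- move=> _ _ _ _; exists (partial_sum z m); first exact: partial_sum_rooted.
  exact: partial_sumS.
- by move=> _ _ _ /andP[].
rewrite ltnS negbK => sz /and3P[bm cb sorted_s] even_s /andP[_ s_pos].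
have [|//|//|//|t tc] := IHn s c; first exact: ltnW.
move=> /= ->.
have lebm : b <= m by rewrite -ltnS.
exists (t + z c.+1 + (partial_sum z m - partial_sum z b)).
  apply: rooted_sums_shift => //.
  exact/(rooted_sums_sub (ltnW cb))/rooted_sums_add.
rewrite partial_sumS; have := leq_partial_sum lebm; lia.
Qed.

End RootedSums.

(** * Finite index sets as decreasing sequences *)

Lemma bigmax_sorted_geq (s : seq nat) :
  sorted geq s -> \max_(j <- s) j = head 0 s.
Proof.
case: s => [|a s] /=; first by rewrite big_nil.
have geq_trans : transitive geq by move=> m n p /= mn /leq_trans; exact.
move=> /(order_path_min geq_trans)/allP le_a.
by rewrite big_cons; apply/maxn_idPl/bigmax_leqP_seq => j /le_a.
Qed.

Lemma sort_ksubset k (J : {fset nat}) : ksubsets k J ->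
  [/\ sorted gtn (sort geq J), all (leq 1) (sort geq J),
      size (sort geq J) = k & head 0 (sort geq J) = \max_(j <- J) j].
Proof.
move=> [Jpos cardJ].
have sorted_geq : sorted geq (sort geq J).
  by apply: sort_sorted => m n; exact: leq_total.
split.
- by rewrite gtn_sorted_uniq_geq sort_uniq fset_uniq.
- by apply/allP => j; rewrite mem_sort => jJ; exact: Jpos.
- by rewrite size_sort.
- by rewrite -bigmax_sorted_geq // (perm_big _ (permEl (perm_sort geq J))).
Qed.

Lemma sorted_ksubset (s : seq nat) : sorted gtn s -> all (leq 1) s ->
  let J := [fset j in s]%fset in
  ksubsets (size s) J /\ sort geq J = s.
Proof.
rewrite gtn_sorted_uniq_geq => /andP[uniq_s sorted_s] s_pos J.
have perm_J : perm_eq J s.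
  by apply: uniq_perm; rewrite ?fset_uniq // => j; rewrite !inE.
split; last first.
  apply: (sorted_eq (leT := geq)) => //.
  - by move=> m n p /= mn /leq_trans; exact.
  - by move=> m n; rewrite /= andbC -eqn_leq => /eqP.
  - by apply: sort_sorted => m n; exact: leq_total.
  - by rewrite perm_sort.
split; last exact: perm_size.
by move=> j /=; rewrite (perm_mem perm_J) => /(allP s_pos).
Qed.

Lemma sumalt_partial_sum z k (J : {fset nat}) : odd k -> ksubsets k J ->
  exists m t, [/\ \max_(j <- J) j = m.+1, t \in rooted_sums z m &
                  sumalt (partial_sum z) J = t + z m.+1].
Proof.
move=> odd_k /sort_ksubset[]; rewrite /sumalt.
case: (sort geq J) => [_ _ k0|[|m] s sorted_s s_pos size_s <-] //.
  by rewrite -k0 in odd_k.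
have [//|||t tm ->] := @altsum_partial_sum z m s; last by exists m, t.
- by move: odd_k; rewrite -size_s.
- by have /andP[] := s_pos.
Qed.

(** * Colorings along an idempotent ultrafilter *)

Lemma near_forall_fset (T : Type) (I : choiceType) (F : set_system T)
    (L : {fset I}) (P : I -> set T) : Filter F ->
  {in L, forall i, \forall x \near F, P i x} ->
  \forall x \near F, {in L, forall i, P i x}.
Proof. by move=> FF; exact: filter_bigI. Qed.

Lemma near_forall_fset2 (T : Type) (I : choiceType) (F : set_system T)
    (L : {fset I}) (P : I -> I -> set T) : Filter F ->
  {in L &, forall i j, \forall x \near F, P i j x} ->
  \forall x \near F, {in L &, forall i j, P i j x}.
Proof.
move=> FF FP.
have : \forall x \near F, {in L, forall i, {in L, forall j, P i j x}}.
  by apply: near_forall_fset => i iL; apply: near_forall_fset => j; exact: FP.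
by apply: filterS => x PL i j iL; exact: PL.
Qed.

Section IdempotentUltrafilter.
Variable U : set_system nat.
Hypotheses (ultraU : UltraFilter U) (idemU : U `<=` filter_mul addn U U).

Let properU : ProperFilter U := @ultra_proper _ _ ultraU.

Lemma ultra_near_not (P : set nat) :
  ~ (\forall x \near U, P x) -> \forall x \near U, ~ P x.
Proof. by move=> nUP; have [] := in_ultra_setVsetC P ultraU. Qed.

Section Germs.
Variables (C : Type) (f : nat -> C).

Definition shift_stable a : Prop := \forall b \near U, f (a + b) = f a.

(* The class of [y |-> f (s + y)] modulo equality [U]-almost everywhere, as a
   set of functions, so that [germ] is itself a coloring of the naturals. *)
Definition germ s : set (nat -> C) :=
  [set g | \forall y \near U, g y = f (s + y)].

Lemma germP s t : germ s = germ t <-> \forall y \near U, f (s + y) = f (t + y).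
Proof.
split=> [st|fst].
  have : germ s (fun y => f (s + y)) by exact: nearW.
  by rewrite st.
apply/seteqP; split=> g; move: fst; apply: (@filterS2 _ U) => y.
  by move=> ->.
by move=> <-.
Qed.

Lemma near_color_add s c : (\forall y \near U, f (s + y) = c) ->
  \forall x \near U, \forall y \near U, f (s + x + y) = c.
Proof.
move=> /idemU; apply: (@filterS _ U) => x; apply: filterS => y.
by rewrite /= addnA.
Qed.

Lemma unstable_near_neq : (forall a, ~ shift_stable a) ->
  forall s c, \forall x \near U, f (s + x) <> c.
Proof.
move=> unstable s c; apply: ultra_near_not => fc.
have [x [fx fxc]] := filter_ex (filterI fc (near_color_add fc)).
by apply: (unstable (s + x)); apply: filterS fxc => b ->.
Qed.

Lemma near_adjoin_injective (L : {fset nat}) : (forall a, ~ shift_stable a) ->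
  {in L &, injective f} -> {in L &, injective germ} ->
  \forall d \near U, {in adjoin L d &, injective f}.
Proof.
move=> unstable inj_f inj_germ.
have ne_old : \forall d \near U, {in L &, forall s t, f (s + d) <> f t}.
  by apply: near_forall_fset2 => s t _ _; exact: unstable_near_neq.
have inj_new : \forall d \near U,
    {in L &, forall s t, f (s + d) = f (t + d) -> s = t}.
  apply: near_forall_fset2 => s t sL tL.
  have [->|/eqP st] := eqVneq s t; first exact: nearW.
  have /germP/ultra_near_not : germ s <> germ t by move=> /(inj_germ _ _ sL tL).
  by apply: filterS => d ne_d /ne_d.
by apply: filterS2 ne_old inj_new => d; exact: adjoin_injective.
Qed.

End Germs.

Lemma near_germ_add C (f : nat -> C) s t : germ f s = germ f t ->
  \forall d \near U, germ f (s + d) = germ f (t + d).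
Proof.
move=> /germP/idemU; apply: (@filterS _ U) => d fd; apply/germP.
by apply: filterS fd => y; rewrite !addnA.
Qed.

Lemma germ_germ_injective C (f : nat -> C) s t :
  germ (germ f) s = germ (germ f) t -> germ f s = germ f t.
Proof.
move=> /germP germ_st; apply/germP; apply: contrapT => /ultra_near_not.
move=> /idemU nf; have [d [/germP fd nfd]] := filter_ex (filterI germ_st nf).
have [y [/= fy]] := filter_ex (filterI fd nfd).
by apply; rewrite !addnA.
Qed.

Section Greedy.
Hypothesis ooU : \oo `<=` U.

Lemma greedy_rooted_sums (I : {fset nat} -> Prop)
    (Q : {fset nat} -> nat -> Prop) a :
  I [fset a]%fset ->
  (forall L, I L -> \forall d \near U, I (adjoin L d) /\ Q L d) ->
  exists z, [/\ z 0 = a, forall n, 0 < z n.+1, forall n, I (rooted_sums z n) &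
                forall n, Q (rooted_sums z n) (z n.+1)].
Proof.
move=> Ia step.
have [L|next nextP] := @choice _ _ (fun L d => I L ->
    [/\ 0 < d, I (adjoin L d) & Q L d]).
  have [IL|] := pselect (I L); last by exists 0.
  have pos : \forall d \near U, 0 < d by apply: ooU; exists 1.
  by have [d [[IL' QL] d0]] := filter_ex (filterI (step _ IL) pos); exists d.
pose stage n := iter n (fun L => adjoin L (next L)) [fset a]%fset.
pose z n := if n is m.+1 then next (stage m) else a.
have stageE n : rooted_sums z n = stage n by elim: n => //= n ->.
have I_stage n : I (stage n) by elim: n => //= n /nextP[].
by exists z; split=> // n; rewrite ?stageE //; have [] := nextP _ (I_stage n).
Qed.

Lemma exists_monochromatic_sums (D : nat -> nat) a :
  shift_stable D a ->
  exists2 z, forall n, 0 < z n.+1 & monochromatic D (all_rooted_sums z).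
Proof.
move=> stable_a.
pose constant_germ s := D s = D a /\ \forall y \near U, D (s + y) = D a.
have [||z [_ z_pos z_const _]] :=
    @greedy_rooted_sums (fun L => {in L, forall s, constant_germ s})
      (fun _ _ => True) a; last first.
- by exists z => //; exists (D a) => s [n /z_const[]].
- move=> L L_const.
  have : \forall d \near U, {in L, forall s, constant_germ (s + d)}.
    apply: near_forall_fset => s /L_const[_ sD].
    by apply: filterS2 sD (near_color_add sD) => d; split.
  apply: filterS => d d_const; split=> // s /adjoinP[/L_const//|].
  by move=> [t /d_const ? ->].
- by move=> s; rewrite inE => /eqP->.
Qed.

Definition colored_by_last_term (C : Type) (D : nat -> C) (z : nat -> nat) :
  Prop :=
  forall n s, s \in rooted_sums z n ->
    D (s + z n.+1) = D (partial_sum z n.+1) /\ D s <> D (partial_sum z n.+1).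

Lemma exists_last_term_sums (D : nat -> nat) a :
  (forall b, ~ shift_stable D b) -> shift_stable (germ D) a ->
  exists2 z, forall n, 0 < z n.+1 & colored_by_last_term D z.
Proof.
move=> unstable germ_a.
have [||z [_ z_pos _ z_color]] :=
    @greedy_rooted_sums (fun L => {in L, forall s, germ D s = germ D a})
      (fun L d => {in L, forall s, D (s + d) = D (a + d) /\ D s <> D (a + d)})
      a; last first.
- exists z => // n s /z_color[-> neD].
  by rewrite partial_sumS; have [-> _] := z_color n _ (partial_sum_rooted z n).
- move=> L L_germ; have : \forall d \near U, {in L, forall s,
      germ D (s + d) = germ D a /\ (D (s + d) = D (a + d) /\ D s <> D (a + d))}.
    apply: near_forall_fset => s /L_germ germ_s.
    have sD : \forall d \near U, D (s + d) = D (a + d) by apply/germP.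
    apply: filterS2 (filterI sD (near_germ_add germ_s))
      (filterI germ_a (unstable_near_neq unstable a (D s))).
    by move=> d [sdD ->] [-> /nesym].
  apply: filterS => d d_germ; split.
    by move=> _ /adjoinP[/L_germ//|[s /d_germ[? _] ->]].
  by move=> s /d_germ[].
- by move=> s; rewrite inE => /eqP->.
Qed.

Lemma exists_rainbow_sums (D : nat -> nat) :
  (forall a, ~ shift_stable D a) -> (forall a, ~ shift_stable (germ D) a) ->
  exists2 z, forall n, 0 < z n.+1 & rainbow D (all_rooted_sums z).
Proof.
move=> unstableD unstable_germ.
have [||z [_ z_pos z_inj _]] := @greedy_rooted_sums
    (fun L => {in L &, injective D} /\ {in L &, injective (germ D)})
    (fun _ _ => True) 0; last first.
- exists z => // s t [m sm] [n tn] st Dst; apply: st.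
  have [injD _] := z_inj (maxn m n).
  by apply: injD Dst;
    [apply: rooted_sums_sub sm|apply: rooted_sums_sub tn]; lia.
- move=> L [injD inj_germ].
  have injD' : \forall d \near U, {in adjoin L d &, injective D}.
    exact: near_adjoin_injective.
  have inj_germ' : \forall d \near U, {in adjoin L d &, injective (germ D)}.
    apply: near_adjoin_injective => // s t sL tL /germ_germ_injective.
    exact: inj_germ.
  by apply: filterS2 injD' inj_germ'.
- by split=> s t; rewrite !inE => /eqP-> /eqP->.
Qed.

End Greedy.

End IdempotentUltrafilter.

Theorem canonical_rooted_sums (D : nat -> nat) :
  exists2 z, forall n, 0 < z n.+1 &
    [\/ monochromatic D (all_rooted_sums z), rainbow D (all_rooted_sums z)
      | colored_by_last_term D z].
Proof.
have [U [ultraU ooU idemU]] := exists_idempotent_ultrafilter_nat.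
have [[a stable_a]|/forallNP unstableD] :=
    pselect (exists a, shift_stable U D a).
  have [z z_pos z_mono] := exists_monochromatic_sums ultraU idemU ooU stable_a.
  by exists z => //; apply: Or31.
have [[a stable_germ]|/forallNP unstable_germ] :=
    pselect (exists a, shift_stable U (germ U D) a).
  have [z z_pos z_last] :=
    exists_last_term_sums ultraU idemU ooU unstableD stable_germ.
  by exists z => //; apply: Or33.
have [z z_pos z_rainbow] :=
  exists_rainbow_sums ultraU idemU ooU unstableD unstable_germ.
by exists z => //; apply: Or32.
Qed.

(** * From rooted sums to alternating sums *)

Lemma increasing_enum_image (x : nat -> nat) : {homo x : i j / i < j} ->
  infinite_set_of_posint (x @` posint) /\ increasing_enum x (x @` posint).
Proof.
move=> incr_x; split; last by split=> // i j _; exact: incr_x.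
split; first by move=> _ [i i_pos <-]; exact: leq_ltn_trans (incr_x 0 i i_pos).
have inj_x : {in posint &, injective x}.
  move=> i j _ _ xij.
  by have [/incr_x|/incr_x|//] := ltngtP i j; rewrite xij ltnn.
rewrite (eq_finite_set (inj_card_eq inj_x)).
have -> : posint = [set: nat] `\` [set 0].
  by apply/seteqP; split=> -[|n] //= [].
exact: infinite_setD infinite_nat (finite_set1 _).
Qed.

Section Patterns.
Variables (k : nat) (z : nat -> nat).
Hypothesis odd_k : odd k.
Local Notation x := (partial_sum z).

Lemma setU_Xalt_sub_rooted_sums :
  (x @` posint) `|` Xalt k x `<=` all_rooted_sums z.
Proof.
move=> _ [[n _ <-]|[J kJ <-]]; first by exists n; exact: partial_sum_rooted.
have [m [t [_ tm ->]]] := sumalt_partial_sum z odd_k kJ.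
by exists m.+1; exact: rooted_sums_add.
Qed.

Lemma pattern_max_last_term D :
  colored_by_last_term D z -> pattern_max k D (x @` posint) x.
Proof.
move=> D_last; split; last first.
  move=> J kJ; have [m [t [-> tm ->]]] := sumalt_partial_sum z odd_k kJ.
  by have [] := D_last m t tm.
have rainbow_lt i j : i < j -> D (x i) <> D (x j).
  case: j => // j ij; have xi_rooted : x i \in rooted_sums z j.
    exact: rooted_sums_sub (partial_sum_rooted z i).
  by have [] := D_last j _ xi_rooted.
move=> _ _ [i _ <-] [j _ <-] xij.
by have [/rainbow_lt//|/rainbow_lt/nesym//|ij] := ltngtP i j; rewrite ij in xij.
Qed.

End Patterns.

Theorem canonical_alternating_sums (k : nat) (D : nat -> nat) : odd k ->
  exists (X : set nat) (x : nat -> nat),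
    [/\ infinite_set_of_posint X, increasing_enum x X &
        [\/ pattern_mono k D X x, pattern_rainbow k D X x
          | pattern_max k D X x]].
Proof.
move=> odd_k; have [z z_pos z_pattern] := canonical_rooted_sums D.
have incr_x : {homo partial_sum z : i j / i < j}.
  apply: homo_ltn => [? ? ?|n]; first exact: ltn_trans.
  by rewrite partial_sumS -addn1 leq_add2l.
have [Xinf Xenum] := increasing_enum_image incr_x.
exists (partial_sum z @` posint), (partial_sum z); split=> //.
have subX := @setU_Xalt_sub_rooted_sums k z odd_k.
case: z_pattern => [[c Dc]|z_rainbow|z_last].
- by apply: Or31; exists c => s /subX/Dc.
- by apply: Or32 => s t /subX sz /subX tz; exact: z_rainbow.
- by apply: Or33; exact: pattern_max_last_term.
Qed.

(** * Necessity of the three patterns *)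

Section IncreasingEnumeration.
Variables (X : set nat) (x : nat -> nat).
Hypotheses (X_pos : X `<=` posint) (enumX : increasing_enum x X).

Lemma enum_ltn i j : 0 < i -> i < j -> x i < x j.
Proof. by have [incr_x _] := enumX; exact: incr_x. Qed.

Lemma enum_in i : 0 < i -> X (x i).
Proof. by have [_ ->] := enumX => i_pos; exists i. Qed.

Lemma enum_gt0 i : 0 < i -> 0 < x i.
Proof. by move=> /enum_in/X_pos. Qed.

Lemma enum_addn_leq i m : 0 < i -> x i + m <= x (i + m).
Proof.
move=> i_pos; elim: m => [|m IHm]; first by rewrite !addn0.
have : x (i + m) < x (i + m.+1) by apply: enum_ltn; lia.
lia.
Qed.

Lemma altsum_ltn j (s : seq nat) :
  sorted gtn (j :: s) -> all (leq 1) (j :: s) ->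
  altsum [seq x i | i <- s] < x j.
Proof.
have [n] := ubnP (size s); elim: n j s => // n IHn j [|a [|b s]] /=.
- by move=> _ _ /andP[/enum_gt0].
- by move=> _ /andP[aj _] /and3P[_ a_pos _]; exact: enum_ltn.
rewrite ltnS => size_s /and3P[aj ba sorted_s] /and4P[_ a_pos b_pos s_pos].
have lt_b : altsum [seq x i | i <- s] < x b.
  by apply: IHn; rewrite /= ?sorted_s ?b_pos //; exact: ltnW.
have := enum_ltn b_pos ba; have := enum_ltn a_pos aj; lia.
Qed.

(* [c] is the alternating sum over the fixed indices 1, ..., k - 2. *)
Lemma sumalt_two_largest k : 1 < k -> exists c, forall b n,
  k - 2 < b -> b < n -> c < x b /\
  exists J, [/\ ksubsets k J, \max_(j <- J) j = n & sumalt x J = x n - x b + c].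
Proof.
move=> k_gt1; pose s := rev (iota 1 (k - 2)).
exists (altsum [seq x j | j <- s]) => b n kb bn.
have sorted_b : sorted gtn (b :: s).
  rewrite /= path_sortedE ?rev_sorted ?iota_ltn_sorted ?andbT.
    by apply/allP => j; rewrite mem_rev mem_iota /=; lia.
  by move=> i j l /= ji /ltn_trans; exact.
have pos_b : all (leq 1) (b :: s).
  by apply/allP => j; rewrite inE mem_rev mem_iota; lia.
split; first exact: altsum_ltn.
have [||kJ sortJ] := @sorted_ksubset [:: n, b & s].
- by rewrite /= bn.
- by rewrite /= (ltn_trans _ bn) //; lia.
have size_s : size [:: n, b & s] = k by rewrite /= size_rev size_iota; lia.
rewrite size_s in kJ; exists [fset j in [:: n, b & s]]%fset; split=> //.
  by have [_ _ _ <-] := sort_ksubset kJ; rewrite sortJ.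
by rewrite /sumalt sortJ.
Qed.

Lemma const_not_rainbow_max k c :
  ~ (pattern_rainbow k (fun=> c) X x \/ pattern_max k (fun=> c) X x).
Proof.
have X1 : X (x 1) by exact: enum_in.
have X2 : X (x 2) by exact: enum_in.
have x12 : x 1 <> x 2 by have := @enum_ltn 1 2 isT isT; lia.
by case=> [rainbowX|[rainbowX _]]; apply: (rainbowX _ _ _ _ x12) => //; left.
Qed.

Lemma id_not_mono_max k : 1 < k ->
  ~ (pattern_mono k id X x \/ pattern_max k id X x).
Proof.
move=> k_gt1 [[c id_c]|[_ id_max]].
  have xc i : 0 < i -> x i = c.
    by move=> i_pos; apply: id_c; left; exact: enum_in.
  by have := @enum_ltn 1 2 isT isT; rewrite !xc // ltnn.
have [c two_largest] := sumalt_two_largest k_gt1.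
have [||c_lt [J [kJ maxJ sumJ]]] := two_largest k.-1 k; [lia..|].
have := id_max J kJ; rewrite maxJ sumJ.
have : x k.-1 < x k by apply: enum_ltn; lia.
lia.
Qed.

End IncreasingEnumeration.

Definition dyadic_coloring (n : nat) : nat := (trunc_log 2 n).+1.

Lemma dyadic_coloring_double n :
  0 < n -> dyadic_coloring n.*2 = (dyadic_coloring n).+1.
Proof. by move=> n_pos; rewrite /dyadic_coloring trunc_log2_double. Qed.

Lemma leq_dyadic_coloring : {homo dyadic_coloring : m n / m <= n}.
Proof. by move=> m n mn; rewrite ltnS leq_trunc_log. Qed.

(* [dyadic_coloring] takes at most two values on [a, 2a]. *)
Lemma dyadic_coloring_not_rainbow (A : set nat) a b c :
  A a -> A b -> A c -> 0 < a -> a < b -> b < c -> c <= a.*2 ->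
  ~ rainbow dyadic_coloring A.
Proof.
move=> Aa Ab Ac a_pos ab bc c2a rainbowA.
have Dab : dyadic_coloring a <> dyadic_coloring b by apply: rainbowA => //; lia.
have Dbc : dyadic_coloring b <> dyadic_coloring c by apply: rainbowA => //; lia.
have leDab := leq_dyadic_coloring (ltnW ab).
have leDbc := leq_dyadic_coloring (ltnW bc).
have := leq_dyadic_coloring c2a; rewrite dyadic_coloring_double //; lia.
Qed.

Lemma dyadic_not_mono_rainbow k X x : 2 < k ->
  X `<=` posint -> increasing_enum x X ->
  ~ (pattern_mono k dyadic_coloring X x \/
     pattern_rainbow k dyadic_coloring X x).
Proof.
move=> k_gt2 X_pos enumX.
have x_pos := enum_gt0 X_pos enumX.
have double_le i : 0 < i -> (x i).*2 <= x (i + x i).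
  by move=> i_pos; rewrite -addnn; exact: (enum_addn_leq enumX).
case=> [[c D_c]|].
  have Dx i : 0 < i -> dyadic_coloring (x i) = c.
    by move=> i_pos; apply: D_c; left; exact: (enum_in enumX).
  have := leq_dyadic_coloring (double_le 1 isT).
  by rewrite dyadic_coloring_double ?x_pos // !Dx ?ltnn.
have [|c two_largest] := @sumalt_two_largest X x X_pos enumX k; first lia.
pose n := k + x k; have xkn : (x k).*2 <= x n by apply: double_le; lia.
have x_lt : x k.-1 < x k by apply: (enum_ltn enumX); lia.
have kn : k < n by have := x_pos k; lia.
have [||c_lt [J [kJ _ sumJ]]] := two_largest k.-1 n; [lia..|].
have [||_ [J' [kJ' _ sumJ']]] := two_largest k n; [lia..|].
apply: (@dyadic_coloring_not_rainbow _ (sumalt x J') (sumalt x J) (x n)).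
- by right; exists J'.
- by right; exists J.
- by left; apply: (enum_in enumX); lia.
all: lia.
Qed.

Theorem theorem5p1 (k : nat) (k_ge3 : 3 <= k) (k_odd : odd k) :
  (forall D : nat -> nat, coloring D ->
     exists (X : set nat) (x : nat -> nat),
       [/\ infinite_set_of_posint X, increasing_enum x X &
           [\/ pattern_mono k D X x, pattern_rainbow k D X x
             | pattern_max k D X x]]) /\
  [/\ exists D : nat -> nat, coloring D /\
        forall (X : set nat) (x : nat -> nat),
          infinite_set_of_posint X -> increasing_enum x X ->
          ~ (pattern_rainbow k D X x \/ pattern_max k D X x),
      exists D : nat -> nat, coloring D /\
        forall (X : set nat) (x : nat -> nat),
          infinite_set_of_posint X -> increasing_enum x X ->
          ~ (pattern_mono k D X x \/ pattern_max k D X x)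
    & exists D : nat -> nat, coloring D /\
        forall (X : set nat) (x : nat -> nat),
          infinite_set_of_posint X -> increasing_enum x X ->
          ~ (pattern_mono k D X x \/ pattern_rainbow k D X x)].
Proof.
split=> [D _|]; first exact: canonical_alternating_sums.
split.
- by exists (fun=> 1); split=> // X x _ enumX; exact: const_not_rainbow_max.
- exists id; split=> // X x [X_pos _] enumX.
  by apply: id_not_mono_max => //; exact: ltnW.
- exists dyadic_coloring; split=> // X x [X_pos _] enumX.
  exact: dyadic_not_mono_rainbow.
Qed.
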